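(* Let $\mathfrak g$ be of type $B_n$ or $C_n$, $n\ge2$, with positive roots $\Delta^+$, and let $G\subseteq\Delta^+$ be any subset. For $0\le k\le n$ let $\mathtt{Stir}(G,n-k)$ be the number of quasi-antichains of $\Delta^+$ contained in $G$ of cardinality $k$. Then $$\chi(\mathtt{Shi}(G),t)=\sum_{k=0}^n(-1)^k\,\mathtt{Stir}(G,n-k)\prod_{j=k}^{n-1}(t-2j-1),$$ where an empty product (for $k=n$) equals $1$.
   Context: $V=\mathbb R^n$ with the standard inner product $(\,,\,)$. For $C_n$, $\Delta^+=\{e_i\pm e_j\mid1\le i<j\le n\}\cup\{2e_i\mid1\le i\le n\}$; for $B_n$, $\Delta^+=\{e_i\pm e_j\mid1\le i<j\le n\}\cup\{e_i\mid1\le i\le n\}$. $H_{\alpha,k}=\{v\in V\mid(v,\alpha)=k\}$, $\mathtt{Cox}=\{H_{\alpha,0}\mid\alpha\in\Delta^+\}$, and $\mathtt{Shi}(G)=\mathtt{Cox}\cup\{H_{\alpha,1}\mid\alpha\in G\}$. A subset $S\subseteq\Delta^+$ is a quasi-antichain if for any two distinct $\alpha,\beta\in S$, $\alpha-\beta$ is not a nonzero integer multiple of any root. For an arrangement $\mathcal A$ in $V$, $L(\mathcal A)$ is the set of nonempty intersections of subsets of $\mathcal A$ (including $V$) ordered by reverse inclusion, $\mu$ its Möbius function, and $\chi(\mathcal A,t)=\sum_{x\in L(\mathcal A)}\mu(V,x)t^{\dim x}$. *)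

(* Defs.v *)
From HB Require Import structures.
From mathcomp Require Import all_boot all_order all_algebra.
From mathcomp Require Import finmap.
From mathcomp Require Import boolp classical_sets reals.

Set Implicit Arguments.
Unset Strict Implicit.
Unset Printing Implicit Defensive.

Import Order.TTheory GRing.Theory Num.Theory.

Local Open Scope fset_scope.
Local Open Scope ring_scope.

Section Mobius.
Variables (T : choiceType) (le : rel T) (P : {fset T}).

(* The first argument bounds the recursion depth.  Strict chains in [P] have
   at most #|`P| elements, so #|`P| is enough: see [mobius_sum]. *)
Fixpoint mobius_rec (d : nat) (x y : T) : int :=
  if x == y then 1
  else if d is d'.+1 then
    if le x y then - \sum_(z <- P | [&& le x z, le z y & z != y])
                       mobius_rec d' x z
    else 0
  else 0.

Definition mobius (x y : T) : int := mobius_rec #|` P| x y.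

Lemma mobius_id x : mobius x x = 1.
Proof. by rewrite /mobius; case: #|` P| => [|d] /=; rewrite eqxx. Qed.

Hypotheses (le_refl : reflexive le) (le_anti : antisymmetric le).
Hypothesis le_trans : transitive le.

Let below y := #|` [fset z in P | le z y]|.

Let below_lt y z : y \in P -> le z y -> z != y -> (below z < below y)%N.
Proof.
move=> yP lezy neq; apply: fproper_ltn_card; rewrite fproperE.
apply/andP; split; [apply/fsubsetP => w|].
  by rewrite !inE /= => /andP[-> lewz]; rewrite (le_trans lewz lezy).
apply/fsubsetPn; exists y; rewrite !inE /= yP ?le_refl //=.
by apply: contra neq => leyz; apply/eqP/le_anti; rewrite lezy.
Qed.

Let mobius_rec_stable x y d1 d2 : y \in P ->
  (below y <= d1)%N -> (below y <= d2)%N -> mobius_rec d1 x y = mobius_rec d2 x y.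
Proof.
elim: d1 d2 y => [|d1 IHd] [|d2] y yP //=.
- rewrite leqn0 => b0 _; move: (b0); rewrite /below cardfs_eq0 => /eqP/fsetP/(_ y).
  by rewrite !inE /= yP le_refl.
- move=> _; rewrite leqn0 => b0; move: (b0); rewrite /below cardfs_eq0 => /eqP/fsetP/(_ y).
  by rewrite !inE /= yP le_refl.
move=> b1 b2; case: eqP => // _; case: ifP => // _; congr (- _).
rewrite big_seq_cond [RHS]big_seq_cond; apply: eq_bigr => z /and4P[zP _ lezy neq].
have lt_zy := below_lt yP lezy neq.
by apply: IHd => //; rewrite -ltnS; apply: leq_trans lt_zy _.
Qed.

Lemma mobius_sum x y : y \in P -> le x y -> x != y ->
  \sum_(z <- P | le x z && le z y) mobius x z = 0.
Proof.
move=> yP lexy neq; rewrite (bigID (pred1 y)) /=.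
have -> : \sum_(z <- P | (le x z && le z y) && (z == y)) mobius x z = mobius x y.
  rewrite -big_filter (_ : [seq z <- P | _] = [seq z <- P | z == y]); last first.
    apply: eq_filter => z; case: (z =P y) => [->|]; last by rewrite andbF.
    by rewrite lexy le_refl.
  rewrite (_ : [seq z <- P | _] = [:: y]) ?big_seq1 //.
  by rewrite filter_pred1_uniq.
have Pgt0 : (0 < #|` P|)%N by rewrite cardfs_gt0; apply/fset0Pn; exists y.
have -> : mobius x y = - \sum_(z <- P | [&& le x z, le z y & z != y])
                           mobius_rec #|` P|.-1 x z.
  by rewrite /mobius -{1}(prednK Pgt0) /= (negbTE neq) lexy.
apply/eqP; rewrite addrC subr_eq0; apply/eqP.
under eq_bigl => z do rewrite -andbA.
rewrite big_seq_cond [RHS]big_seq_cond.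
apply: eq_bigr => z /and4P[zP _ lezy neqz]; rewrite /mobius.
have bP w : (below w <= #|` P|)%N.
  by apply: fsubset_leq_card; apply/fsubsetP => u; rewrite !inE => /andP[].
apply: mobius_rec_stable => //.
by rewrite -ltnS prednK //; apply: leq_trans (below_lt yP lezy neqz) (bP y).
Qed.

End Mobius.

Section Arrangement.
Variables (R : realType) (n : nat).
Local Notation V := 'rV[R]_n.
Implicit Types (X : set V) (A : {fset set V}) (U : {vspace V}).

Definition inner (u v : V) : R := \sum_i u 0 i * v 0 i.

Definition hyperplane (a : V) (k : R) : set V := [set v | inner v a = k]%classic.

Definition translate (x : V) U : set V := [set v | v - x \in U]%classic.

(* Dimension of an affine subspace; see [affdim_translate]. *)
Definition affdim X : nat :=
  \dim (xget 0%VS [set U | exists x, X = translate x U]%classic).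

Lemma affdim_translate x U : affdim (translate x U) = \dim U.
Proof.
congr (\dim _); apply: xget_unique; first by exists x.
move=> W [y eqUW]; apply/esym/vspaceP => v.
have memE w : (w - x \in U) = (w - y \in W).
  by apply/idP/idP => h; have := congr1 (@^~ w) eqUW;
    rewrite /translate /= => e; [rewrite -e | rewrite e].
have xyW : x - y \in W by rewrite -memE subrr mem0v.
have := memE (v + x); rewrite addrK => ->.
by rewrite -addrA; apply/idP/idP => h; [rewrite -(addrK (x - y) v) rpredB | rewrite rpredD].
Qed.

Definition intersection (B : {fset set V}) : set V :=
  (\bigcap_(H in [set` B]) H)%classic.

(* The empty subfamily contributes the whole space. *)
Definition intersection_poset A : {fset set V} :=
  [fset X in [fset intersection B | B in fpowerset A]
   | `[< (X !=set0)%classic >]].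

Definition rev_incl : rel (set V) := fun X Y => `[< (Y `<=` X)%classic >].

Definition char_poly_arr A : {poly int} :=
  \sum_(X <- intersection_poset A)
     (mobius rev_incl (intersection_poset A) setT X)%:P * 'X^(affdim X).

End Arrangement.

Variant BCtype := TypeB | TypeC.

Section Shi.
Variables (R : realType) (n : nat) (T : BCtype).
Local Notation V := 'rV[R]_n.
Implicit Types (G S : {fset V}).

Definition e_ (i : 'I_n) : V := delta_mx 0 i.

Definition axis_root (i : 'I_n) : V :=
  match T with TypeB => e_ i | TypeC => e_ i *+ 2 end.

Definition pos_roots : {fset V} :=
  [fset e_ ij.1 + e_ ij.2 | ij : 'I_n * 'I_n & (ij.1 < ij.2)%N]
  `|` [fset e_ ij.1 - e_ ij.2 | ij : 'I_n * 'I_n & (ij.1 < ij.2)%N]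
  `|` [fset axis_root i | i : 'I_n].

Definition root_system : {fset V} := pos_roots `|` [fset - a | a in pos_roots].

Definition quasi_antichain S : Prop :=
  S `<=` pos_roots /\
  {in S &, forall a b, a != b ->
     forall (c : V) (m : int), c \in root_system -> m != 0 -> a - b <> c *~ m}.

Definition Cox : {fset set V} := [fset hyperplane a 0 | a in pos_roots].

Definition Shi G : {fset set V} := Cox `|` [fset hyperplane a 1 | a in G].

(* Stir(G, m) counts the quasi-antichains in G of cardinality n - m. *)
Definition Stir G (m : nat) : nat :=
  #|` [fset S in fpowerset G | `[< quasi_antichain S >] & (m + #|` S| == n)%N]|.

End Shi.

(* Main.v *)
Require Import Defs.
From mathcomp Require Import all_boot all_order all_algebra.
From mathcomp Require Import mxabelem zify ring.
From mathcomp Require Import finmap.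
From mathcomp Require Import boolp classical_sets reals.

Set Implicit Arguments.
Unset Strict Implicit.
Unset Printing Implicit Defensive.

Import Order.TTheory GRing.Theory Num.Theory.

(** By the finite field method, chi(Shi(G), p) is, for every large prime p, the
    number of points of F_p^n on no hyperplane of Shi(G).  Inclusion-exclusion
    over the hyperplanes H_{a,1} writes it as an alternating sum over S in G of
    the number of points x off Cox with (x, a) = 1 for all a in S.  If two roots
    of S differ by a nonzero multiple of a root there is no such point.

    Otherwise write p = 2N + 1.  A point off Cox places the n coordinates, up to
    sign, at distinct positions |x_i| in {1, ..., N}, and (x, a) = 1 says that
    two coordinates are adjacent with prescribed signs (or, for an axis root,
    that x_i = 1 in type B and x_i = -N in type C).  Remove the first coordinate.
    If no root of S involves it, it had 2(N - n + 1) possible values; if one does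
    (there is at most one), its position is forced, and deleting this position
    is a bijection onto the configurations of n - 1 coordinates in N - 1
    positions.  Hence the count is the product of the p - 2j - 1 for
    |S| <= j < n.  Two integer polynomials that agree at infinitely many primes
    are equal. *)

(** * Counting placements *)

(* [(i, j, s)] with [i < j] encodes the root [e_i + (-1)^s e_j], and
   [(i, i, false)] the axis root at [i]. *)
Definition code n := ('I_n * 'I_n * bool)%type.

Definition valid n (e : code n) : bool :=
  (e.1.1 < e.1.2) || (e.1.1 == e.1.2) && ~~ e.2.

(* Combinatorial cases in which the difference of two roots is a multiple of a
   root. *)
Definition conflict n (e f : code n) : bool :=
  (e != f) &&
  [|| e.1.1 == f.1.1,
      (e.1.1 == e.1.2) && (f.1.1 == f.1.2)
    | (e.1.1 < e.1.2) &&
      ((f.1.1 == e.1.2) && ~~ e.2 || (f.1.2 == e.1.2) && (f.2 == e.2))].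

Definition conflict_free n (S : {set code n}) : Prop :=
  {in S, forall e, valid e} /\ {in S &, forall e f, ~~ conflict e f}.

(* Coordinate [i] is [x_i = m + 1] or [x_i = - (m + 1)] when [c i] is
   [(false, m)] or [(true, m)]. *)
Definition config n N := {ffun 'I_n -> bool * 'I_N}.

(** The equation [(x, a) = 1] modulo [p = 2N + 1], read on positions. In type C, [2 x_i = 1] means
    [x_i = -N]. For [e_i + (-1)^s e_j] the terms [x_i] and [(-1)^s x_j] have opposite signs, and the
    positive one is larger by 1 in absolute value. *)
Definition sat (T : BCtype) n N (c : config n N) (e : code n) : bool :=
  let: (i, j, s) := e in
  if i == j then
    match T with
    | TypeB => ~~ (c i).1 && ((c i).2 == 0 :> nat)
    | TypeC => (c i).1 && ((c i).2.+1 == N)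
    end
  else ((c i).1 == (c j).1 (+) ~~ s) &&
    (if (c i).1 then (c j).2 == (c i).2.+1 :> nat
     else (c i).2 == (c j).2.+1 :> nat).

Definition placements T n N (S : {set code n}) : {set config n N} :=
  [set c : config n N | injectiveb (fun i => (c i).2)
                        & [forall e in S, sat T c e]].

Definition lift_code n (e : code n) : code n.+1 :=
  (lift ord0 e.1.1, lift ord0 e.1.2, e.2).

Lemma lift_code_inj n : injective (@lift_code n).
Proof.
move=> [[i j] s] [[k l] r] eq_ef.
have /lift_inj /= -> := congr1 (fun e => e.1.1) eq_ef.
have /lift_inj /= -> := congr1 (fun e => e.1.2) eq_ef.
by have /= -> := congr1 snd eq_ef.
Qed.

Definition lower n (S : {set code n.+1}) : {set code n} :=
  [set e | lift_code e \in S].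

Lemma valid_lift n (e : code n) : valid (lift_code e) = valid e.
Proof. by case: e => [[i j] s]; rewrite /valid /= ltnS (inj_eq lift_inj). Qed.

Lemma conflict_lift n (e f : code n) :
  conflict (lift_code e) (lift_code f) = conflict e f.
Proof.
rewrite /conflict (inj_eq (@lift_code_inj n)).
by case: e f => [[i j] s] [[k l] r] /=; rewrite !(inj_eq lift_inj) ltnS.
Qed.

Lemma conflict_free_lower n (S : {set code n.+1}) :
  conflict_free S -> conflict_free (lower S).
Proof.
case=> vS cS; split=> [e|e f]; first by rewrite inE -valid_lift => /vS.
by rewrite !inE -conflict_lift => eS fS; apply: cS.
Qed.

(** Two distinct roots with the same first index conflict, so each first index occurs at most once;
    this also bounds [#|S|] by [n]. *)
Lemma conflict_free_first_inj n (S : {set code n}) :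
  conflict_free S -> {in S &, injective (fun e : code n => e.1.1)}.
Proof.
case=> _ cS e f eS fS eqef; apply/eqP; have := cS _ _ eS fS.
by rewrite /conflict eqef eqxx /= andbT negbK.
Qed.

Lemma conflict_free_card n (S : {set code n}) : conflict_free S -> #|S| <= n.
Proof.
move=> /conflict_free_first_inj/card_in_imset <-.
by rewrite -[leqRHS]card_ord max_card.
Qed.

(** Validity puts the smaller index first, so a root can only involve coordinate 0 through its first
    index. *)
Lemma valid_lifted n (e : code n.+1) :
  valid e -> e.1.1 != ord0 -> exists f, e = lift_code f.
Proof.
case: e => [[i j] s] /=.
case: (unliftP ord0 i) => [i' ->|->]; last by rewrite eqxx.
case: (unliftP ord0 j) => [j' ->|->] //= _ _; by exists (i', j', s).
Qed.

Lemma lift_code_first n (e : code n) : (lift_code e).1.1 != ord0.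
Proof. by rewrite eq_sym neq_lift. Qed.

Lemma lower_free n (S : {set code n.+1}) : conflict_free S ->
  (forall e, e \in S -> e.1.1 != ord0) -> S = [set lift_code e | e in lower S].
Proof.
case=> vS _ S0; apply/setP=> e; apply/idP/imsetP => [eS|[f]].
  have [f def_e] := valid_lifted (vS _ eS) (S0 _ eS).
  by exists f; rewrite // inE -def_e.
by rewrite finset.inE => fS ->.
Qed.

Lemma lower_rooted n (S : {set code n.+1}) a : conflict_free S ->
  a \in S -> a.1.1 = ord0 -> S = a |: [set lift_code e | e in lower S].
Proof.
move=> cfS aS a0; apply/setP=> e; rewrite in_setU1; apply/idP/orP => [eS|[/eqP->//|]].
  case: (eqVneq e.1.1 ord0) => [e0|e0]; [left|right].
    by apply/eqP; apply: (conflict_free_first_inj cfS) => //; rewrite e0 a0.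
  have [f def_e] := valid_lifted (cfS.1 _ eS) e0.
  by apply/imsetP; exists f; rewrite // inE -def_e.
by case/imsetP=> f; rewrite inE => fS ->.
Qed.

(** * Adding a first coordinate to a configuration *)

Section Extend.
Variables (T : BCtype) (n N : nat).

Definition extend (x : (bool * 'I_N) * config n N) : config n.+1 N :=
  [ffun i => if unlift ord0 i is Some j then x.2 j else x.1].

Definition restrict (c : config n.+1 N) : (bool * 'I_N) * config n N :=
  (c ord0, [ffun j => c (lift ord0 j)]).

Lemma extend0 x : extend x ord0 = x.1.
Proof. by rewrite ffunE unlift_none. Qed.

Lemma extend_lift x j : extend x (lift ord0 j) = x.2 j.
Proof. by rewrite ffunE liftK. Qed.

Lemma extendK : cancel extend restrict.
Proof.
case=> a c; rewrite /restrict extend0; congr (_, _).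
by apply/ffunP=> j; rewrite ffunE extend_lift.
Qed.

Lemma restrictK : cancel restrict extend.
Proof.
move=> c; apply/ffunP=> i; rewrite ffunE /=.
by case: unliftP => [j ->|->] //; rewrite ffunE.
Qed.

Lemma sat_extend x e : sat T (extend x) (lift_code e) = sat T x.2 e.
Proof. by case: e => [[i j] s]; rewrite /= !extend_lift (inj_eq lift_inj). Qed.

Lemma extend_injective x :
  injectiveb (fun i => (extend x i).2) =
  injectiveb (fun i => (x.2 i).2) && [forall i, (x.2 i).2 != x.1.2].
Proof.
apply/injectiveP/andP => [inj|[/injectiveP inj /forallP ne] i k].
  split.
    apply/injectiveP=> i j eqij; apply/(@lift_inj _ ord0)/inj.
    by rewrite !extend_lift.
  apply/forallP=> i; apply/eqP => eqi.
  have /inj/eqP : (extend x (lift ord0 i)).2 = (extend x ord0).2.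
    by rewrite extend_lift extend0.
  by rewrite eq_sym (negbTE (neq_lift _ _)).
case: (unliftP ord0 i) => [i' ->|->]; case: (unliftP ord0 k) => [k' ->|->] //;
  rewrite ?extend_lift ?extend0.
- by move=> /inj ->.
- by move/eqP; rewrite (negbTE (ne _)).
- by move/esym/eqP; rewrite (negbTE (ne _)).
Qed.

Lemma extend_sat_lifted x (S : {set code n}) :
  [forall e in [set lift_code e | e in S], sat T (extend x) e] =
  [forall e in S, sat T x.2 e].
Proof.
apply/forall_inP/forall_inP => [H e eS|H _ /imsetP[e eS ->]].
  by rewrite -sat_extend; apply: H; apply: imset_f.
by rewrite sat_extend H.
Qed.

End Extend.

(** No constraint touches coordinate 0: its sign is free, and its position is any of the [N - n]
    left empty by the others. *)
Lemma card_placements_free T n N (S : {set code n.+1}) : conflict_free S ->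
  (forall e, e \in S -> e.1.1 != ord0) ->
  #|placements T N S| = #|placements T N (lower S)| * (2 * (N - n)).
Proof.
move=> cfS S0; rewrite -sum1_card (reindex (@extend n N)) /=; last first.
  by exists (@restrict n N) => x _; [apply: extendK | apply: restrictK].
rewrite (eq_bigl (fun x : (bool * 'I_N) * config n N =>
  (x.2 \in placements T N (lower S)) && [forall i, (x.2 i).2 != x.1.2])); last first.
  move=> x; rewrite !inE extend_injective {1}(lower_free cfS S0) extend_sat_lifted.
  by rewrite andbAC.
rewrite (eq_bigl (fun x => xpredT x.1 && ((x.2 \in placements T N (lower S))
  && [forall i, (x.2 i).2 != x.1.2]))) //.
rewrite -(pair_big_dep xpredT (fun (a : bool * 'I_N) (c : config n N) =>
  (c \in placements T N (lower S)) && [forall i, (c i).2 != a.2]) (fun _ _ => 1)) /=.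
(* Sum over the other coordinates [c] first; the choices for coordinate 0 then number the same for
   every [c]. *)
rewrite (exchange_big_dep (mem (placements T N (lower S)))) /=; last first.
  by move=> a c _ /andP[].
rewrite -sum_nat_const; apply: eq_bigr => c cW; rewrite cW sum1_card.
move: cW; rewrite inE => /andP[/injectiveP inj _].
rewrite (eq_card (B :=
  mem (finset.setX [set: bool] (~: [set (c i).2 | i in 'I_n])))); last first.
  move=> [b y]; rewrite !inE /=; apply/forallP/idP => [H|H i].
    by apply/imsetP=> -[i _ eqy]; have := H i; rewrite eqy eqxx.
  by apply: contra H => /eqP /= <-; apply: imset_f.
rewrite cardsX cardsT card_bool cardsCs finset.setCK card_ord card_imset //.
by rewrite card_ord.
Qed.

(** * Inserting a position *)

Section Insert.
Variables (T : BCtype) (n N : nat).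

Definition push (b : 'I_N.+1) (c : config n N) : config n N.+1 :=
  [ffun i => ((c i).1, lift b (c i).2)].

Lemma push_inj b : injective (push b).
Proof.
move=> c d /ffunP eq_cd; apply/ffunP=> i; have := eq_cd i; rewrite !ffunE.
case: (c i) (d i) => [s x] [r y] eqi; have /= -> := congr1 fst eqi.
by have /= /lift_inj -> := congr1 snd eqi.
Qed.

Lemma push_injective b c :
  injectiveb (fun i => (push b c i).2) = injectiveb (fun i => (c i).2).
Proof.
apply/injectiveP/injectiveP => inj i j eq_ij; apply: inj.
  by rewrite !ffunE /= eq_ij.
by move: eq_ij; rewrite !ffunE /= => /lift_inj.
Qed.

(** Deleting the empty position [b] keeps neighbours adjacent, and occupied first and last positions
    remain first and last. *)
Lemma sat_push_inv b c e : sat T (push b c) e -> sat T c e.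
Proof.
case: e => [[i j] s]; rewrite /= !ffunE /= /bump.
have := ltn_ord (c i).2; have := ltn_ord (c j).2.
case: (i == j); first by case: T => lt1 lt2 /andP[-> /=]; lia.
move=> lt1 lt2 /andP[-> /=]; case: ifP => _; lia.
Qed.

(** The only sign and position of coordinate 0 that satisfy [a]. A negative entry takes over the
    position of [j], which [push] then moves up by one; a positive entry sits just above [j], which
    stays in place. *)
Definition root_slot (a : code n.+1) (c : config n N) : bool * 'I_N.+1 :=
  if unlift ord0 a.1.2 is Some j then
    let t := (c j).1 (+) ~~ a.2 in
    (t, if t then inord (c j).2 else inord (c j).2.+1)
  else match T with TypeB => (false, ord0) | TypeC => (true, ord_max) end.

Definition insert (a : code n.+1) (c : config n N) : config n.+1 N.+1 :=
  extend (root_slot a c, push (root_slot a c).2 c).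

Lemma insert_inj a : injective (insert a).
Proof.
move=> c d eq_cd; have := congr1 (@restrict _ _) eq_cd.
by rewrite /insert !extendK => -[->] /push_inj.
Qed.

Lemma sat_insert a c : a.1.1 = ord0 -> sat T (insert a c) a.
Proof.
case: a => [[i j] s] /= ->; rewrite /insert /root_slot /=.
case: unliftP => [j' ->|->]; last by rewrite eqxx extend0; case: T => /=.
rewrite (negbTE (neq_lift _ _)) extend0 extend_lift ffunE /= eqxx /=.
have lt := ltn_ord (c j').2; rewrite /bump.
by case: (_ (+) _); rewrite inordK; lia.
Qed.

Lemma sat_slot a (x : (bool * 'I_N.+1) * config n N) : a.1.1 = ord0 ->
  sat T (extend (x.1, push x.1.2 x.2)) a -> x.1 = root_slot a x.2.
Proof.
case: a x => [[i j] s] [[t b] c] /= ->; rewrite /root_slot /=.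
case: unliftP => [j' ->|->]; last first.
  rewrite eqxx extend0 /=; case: T => /andP[].
    by case: t => //= _ /eqP b0; congr (_, _); apply/val_inj.
  by case: t => //= _ /eqP b0; congr (_, _); apply/val_inj => /=; lia.
rewrite (negbTE (neq_lift _ _)) extend0 extend_lift ffunE /= => /andP[/eqP -> slot].
have lt := ltn_ord (c j').2; have ltb := ltn_ord b; congr (_, _); apply/val_inj.
by move: slot; rewrite /bump; case: (_ (+) _) => /=; rewrite inordK; lia.
Qed.

(* Inserting a position only breaks a constraint whose two points it separates;
   these are the constraints in conflict with the root being inserted. *)
Lemma sat_push a (c : config n N) e : valid a -> a.1.1 = ord0 -> valid e ->
  injectiveb (fun i => (c i).2) -> ~~ conflict a (lift_code e) ->
  sat T c e -> sat T (push (root_slot a c).2 c) e.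
Proof.
case: a e => [[i0 j] s] [[k l] r] /= va def0; rewrite {i0}def0 /= in va *.
move=> ve /injectiveP inj.
(* The first index of a lifted code is nonzero, so a conflict by equal first indices cannot
   occur. *)
have -> : conflict (ord0, j, s) (lift_code (k, l, r)) =
  (j == ord0) && (k == l) || (j != ord0) &&
      ((lift ord0 k == j) && ~~ s || (lift ord0 l == j) && (r == s)).
  by rewrite /conflict /= (inj_eq lift_inj) eq_sym -lt0n.
rewrite /root_slot /=; case: unliftP => [j' ->|->]; last first.
  rewrite eqxx /= orbF => /negbTE -> /andP[e1]; rewrite /= !ffunE /= e1 /=.
  have := ltn_ord (c k).2; have := ltn_ord (c l).2.
  by rewrite /bump; case: T => /=; case: ifP => _; lia.
rewrite eq_sym (negbTE (neq_lift _ _)) /= !(inj_eq lift_inj).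
rewrite !ffunE /=.
have ltk := ltn_ord (c k).2; have ltl := ltn_ord (c l).2; have ltj := ltn_ord (c j').2.
(* Injectivity turns equality of indices into equality of positions, which leaves a purely
   arithmetic case analysis. *)
have kj : (k == j') = ((c k).2 == (c j').2 :> nat) by apply/eqP/eqP => [->|/val_inj/inj].
have lj : (l == j') = ((c l).2 == (c j').2 :> nat) by apply/eqP/eqP => [->|/val_inj/inj].
have ckj : k == j' -> (c k).1 = (c j').1 by move/eqP->.
have clj : l == j' -> (c l).1 = (c j').1 by move/eqP->.
move: ve; rewrite /valid /=.
set b := nat_of_ord (if _ then _ else _).
have -> : b = if (c j').1 (+) ~~ s then (c j').2 : nat else (c j').2.+1.
  by rewrite /b; case: ifP => _; rewrite inordK; lia.
rewrite /bump; case: (eqVneq k l) => [eq_kl|ne_kl].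
  move: eq_kl clj lj => <- _ _; rewrite ltnn /=.
  by case: T; move: ckj kj; move: (c k).1 (c j').1 => [] [];
     case: s r {va b} => [] [] /=; lia.
rewrite orbF => _.
by move: ckj clj kj lj; move: (c k).1 (c l).1 (c j').1 => [] [] [];
   case: s r {va b} => [] [] /=; lia.
Qed.

End Insert.

(** The root [a] forces the entry of coordinate 0, so [insert] is a bijection from the placements of
    the other coordinates in one position fewer. *)
Lemma card_placements_rooted T n N (S : {set code n.+1}) a :
  conflict_free S -> a \in S -> a.1.1 = ord0 ->
  #|placements T N.+1 S| = #|placements T N (lower S)|.
Proof.
move=> cfS aS a0.
have -> : placements T N.+1 S = [set insert T a c | c in placements T N (lower S)].
  apply/setP=> c; apply/idP/imsetP => [|[d]].
    rewrite -(restrictK c); move: (restrict c) => x.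
    rewrite inE extend_injective => /andP[/andP[injx /forallP ne] /forall_inP satx].
    (* No other coordinate shares the position of coordinate 0, so each of their positions is a
       [lift] from the shorter range. *)
    have /fin_all_exists[h hP] : forall i, exists y : 'I_N, (x.2 i).2 = lift x.1.2 y.
      by move=> i; have := ne i; rewrite eq_sym => /unlift_some[y eqy _]; exists y.
    pose d : config n N := [ffun i => ((x.2 i).1, h i)].
    have x2E : x.2 = push x.1.2 d.
      by apply/ffunP=> i; rewrite !ffunE /= -hP -surjective_pairing.
    have xE : x = (x.1, push x.1.2 d) by rewrite -x2E; case: (x).
    have slotE : x.1 = root_slot T a d.
      by apply: (sat_slot (x := (x.1, d))) => //=; rewrite -xE; apply: satx.
    exists d; last by rewrite /insert -slotE -xE.
    rewrite inE -(push_injective x.1.2) -x2E injx /=.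
    apply/forall_inP=> e; rewrite inE => /satx; rewrite sat_extend x2E.
    exact: sat_push_inv.
  rewrite inE => /andP[injd /forall_inP satd] ->.
  rewrite inE extend_injective /= push_injective injd /=; apply/andP; split.
    by apply/forallP=> i; rewrite ffunE /= eq_sym neq_lift.
  apply/forall_inP=> e; rewrite {1}(lower_rooted cfS aS a0) in_setU1.
  case/orP=> [/eqP->|/imsetP[f fS ->]]; first exact: sat_insert.
  rewrite sat_extend /=; move: (fS); rewrite inE => lfS.
  apply: sat_push => //; first exact: cfS.1.
  - by rewrite -valid_lift; apply: cfS.1.
  - exact: cfS.2.
  - exact: satd.
by rewrite card_imset //; apply: insert_inj.
Qed.

(** Induction on the first coordinate. A rooted step lowers [n], [N] and [#|S|] together, which
    shifts the index [j] by one; a free step splits off the last factor. *)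
Lemma card_placements T n N (S : {set code n}) : conflict_free S -> n <= N ->
  #|placements T N S| = \prod_(#|S| <= j < n) (2 * (N - j)).
Proof.
elim: n N S => [|n IHn] N S cfS leN.
  have S0 : S = finset.set0 by apply/setP=> -[[[]]].
  rewrite S0 cards0 big_geq // (_ : placements _ _ _ = finset.setT).
    by rewrite cardsT card_ffun card_ord.
  apply/setP=> c; rewrite !inE; apply/andP; split.
    by apply/injectiveP=> -[].
  by apply/forall_inP=> e; rewrite inE.
have cfS' := conflict_free_lower cfS.
case: (boolP [exists e in S, e.1.1 == ord0]) =>
    [/exists_inP[a aS /eqP a0]|/exists_inPn S0].
  case: N leN => // N leN.
  rewrite (card_placements_rooted T N cfS aS a0) IHn //.
  rewrite {2}(lower_rooted cfS aS a0) cardsU1 card_imset; last exact: lift_code_inj.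
  rewrite (_ : a \notin _) ?big_add1 //.
  apply/imsetP=> -[f _ /(congr1 (fun e => e.1.1)) eq0].
  by have := lift_code_first f; rewrite -eq0 a0 eqxx.
rewrite card_placements_free // IHn //; last exact: ltnW.
rewrite {2}(lower_free cfS S0) card_imset; last exact: lift_code_inj.
by rewrite big_nat_recr //=; apply: conflict_free_card.
Qed.

Local Open Scope ring_scope.

(** * The finite field method *)

(** The relations are triangular: the one at [y] determines [m y] from the values strictly below, so
    induction on the number of elements below [y] applies. This serves to recognise a closed formula
    for the Moebius function. *)
Lemma mobius_unique (T : choiceType) (le : rel T) (P : {fset T}) x (m : T -> int) :
  reflexive le -> antisymmetric le -> transitive le ->
  x \in P -> (forall y, y \in P -> le x y) ->
  (forall y, y \in P -> \sum_(z <- P | le z y) m z = (y == x)%:R) ->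
  forall y, y \in P -> mobius le P x y = m y.
Proof.
move=> le_refl le_anti le_trans xP x_min m_sum.
have mob_sum y : y \in P -> \sum_(z <- P | le z y) mobius le P x z = (y == x)%:R.
  move=> yP; case: (eqVneq y x) => [->|neq].
    rewrite -big_filter (_ : [seq z <- P | le z x] = [:: x]) ?big_seq1 ?mobius_id //.
    rewrite -(filter_pred1_uniq (fset_uniq P) xP); apply: eq_in_filter => z zP /=.
    apply/idP/eqP => [lezx|->]; last exact: le_refl.
    by apply: le_anti; rewrite lezx x_min.
  rewrite -[RHS](mobius_sum le_refl le_anti le_trans yP (x_min y yP)) 1?eq_sym //.
  rewrite big_seq_cond [RHS]big_seq_cond; apply: eq_bigl => z.
  by case: (boolP (z \in P)) => //= /x_min ->.
pose below y := #|` [fset z in P | le z y]%fset|.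
move=> y; move: {2}(below y).+1 (ltnSn (below y)) => k.
elim: k y => // k IHk y; rewrite ltnS => ltk yP.
have := mob_sum y yP; rewrite -(m_sum y yP) => /eqP.
rewrite -subr_eq0 -sumrB -big_filter (bigD1_seq y) ?mem_filter ?le_refl //=;
  last exact/filter_uniq/fset_uniq.
rewrite big_seq_cond big1 ?addr0 ?subr_eq0 => [/eqP//|z].
rewrite mem_filter -andbA => /and3P[lezy zP neq].
rewrite IHk ?subrr //; apply: leq_trans ltk.
apply: fproper_ltn_card; rewrite fproperE; apply/andP; split.
  apply/fsubsetP=> w; rewrite !inE /= => /andP[-> lewz].
  by rewrite (le_trans _ _ _ lewz lezy).
apply/fsubsetPn; exists y; rewrite !inE /= yP ?le_refl //=.
by apply: contra neq => leyz; apply/eqP/le_anti; rewrite lezy.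
Qed.

(** Expand the product over [i] of [1 - [i in D]]: subsets not inside [D] contribute 0, and any
    element of [D] makes a factor vanish. *)
Lemma sum_sign_subsets (I : finType) (D : {set I}) :
  \sum_(J : {set I} | J \subset D) (-1) ^+ #|J| = (D == finset.set0)%:R :> int.
Proof.
transitivity (\prod_i (- (i \in D)%:R + 1) : int).
  rewrite bigA_distr /= [RHS](bigID (fun J : {set I} => J \subset D)) /=.
  rewrite [X in _ + X]big1 ?addr0 => [|J /fintype.subsetPn[i iJ iD]]; last first.
    by rewrite (bigD1 i) //= iJ (negbTE iD) oppr0 mul0r.
  apply: eq_bigr => J /fintype.subsetP JD.
  rewrite -prodr_const big_mkcond; apply: eq_bigr => i _.
  by case: ifP => // /JD ->.
have [->|[i iD]] := set_0Vmem D.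
  by rewrite eqxx big1 // => i _; rewrite finset.inE oppr0 add0r.
rewrite (bigD1 i) //= iD addNr mul0r; case: eqP => // D0.
by rewrite D0 finset.inE in iD.
Qed.

(** * Whitney's theorem *)

Section Whitney.
Variables (R : realType) (n : nat) (I : finType) (H : I -> set 'rV[R]_n).
Local Notation V := 'rV[R]_n.

Definition cap (J : {set I}) : set V := [set v | forall i, i \in J -> H i v]%classic.

Definition hyps : {fset set V} := [fset H i | i in I]%fset.

Lemma in_intersection_poset X :
  reflect ((X !=set0)%classic /\ exists J, X = cap J) (X \in intersection_poset hyps).
Proof.
apply: (iffP idP).
  rewrite !inE /= => /andP[/imfsetP[B /= BA ->] /asboolP ne0]; split=> //.
  exists [set i | H i \in B]; apply/seteqP; split=> v vB.
    by move=> i; rewrite finset.inE => iB; apply: vB.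
  move=> h /= hB; move: BA; rewrite fpowersetE => /fsubsetP/(_ h hB)/imfsetP[i /= _ def_h].
  by rewrite def_h; apply: vB; rewrite finset.inE -def_h.
case=> ne0 [J def_X]; rewrite !inE /=; apply/andP; split; last exact/asboolP.
apply/imfsetP; exists [fset H i | i in J]%fset => /=.
  rewrite fpowersetE; apply/fsubsetP=> h /imfsetP[i /= iJ ->].
  by apply/imfsetP; exists i.
rewrite def_X; apply/seteqP; split=> v vJ.
  by move=> h /= /imfsetP[i /= iJ ->]; apply: vJ.
by move=> i iJ; apply: vJ; apply/imfsetP; exists i.
Qed.

Lemma cap0 : cap finset.set0 = setT.
Proof. by apply/seteqP; split=> // v _ i; rewrite finset.inE. Qed.

Lemma setT_in_poset : setT \in intersection_poset hyps.
Proof. by apply/in_intersection_poset; split; [exists 0 | exists finset.set0; rewrite cap0]. Qed.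

(** By [mobius_unique] it suffices to sum the right-hand side over the flats containing [Y]. This
    gives the alternating sum over all subsets of [D], the indices [i] with [Y] inside [H i], which
    vanishes unless [D] is empty, that is, unless [Y] is the whole space. *)
Lemma mobius_hyps X : (forall i, H i <> setT) -> X \in intersection_poset hyps ->
  mobius (@rev_incl R n) (intersection_poset hyps) setT X =
  \sum_(J | cap J == X) (-1) ^+ #|J|.
Proof.
move=> HnT XP; apply: (mobius_unique (m := fun X => \sum_(J | cap J == X) (-1) ^+ #|J|)) XP.
- by move=> Y; apply/asboolP.
- by move=> Y Z /andP[/asboolP YZ /asboolP ZY]; apply/seteqP.
- by move=> Y Z W /asboolP YZ /asboolP YW; apply/asboolP; apply: subset_trans YW YZ.
- exact: setT_in_poset.
- by move=> Y _; apply/asboolP.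
move=> Y /in_intersection_poset[[v vY] [J0 def_Y]].
rewrite (exchange_big_dep xpredT) //=.
pose D := [set i | `[< (Y `<=` H i)%classic >]].
have subD (J : {set I}) : (J \subset D) = rev_incl (cap J) Y.
  apply/fintype.subsetP/asboolP => [JD w wY i /JD|YJ i iJ].
    by rewrite finset.inE => /asboolP; apply.
  by rewrite finset.inE; apply/asboolP => w /YJ; apply.
transitivity (\sum_(J : {set I} | J \subset D) (-1) ^+ #|J| : int).
  rewrite [RHS]big_mkcond; apply: eq_bigr => J _; rewrite subD.
  rewrite -big_filter; case: ifP => YJ.
    have JP : cap J \in intersection_poset hyps.
      apply/in_intersection_poset; split; last by exists J.
      by exists v; move/asboolP: YJ; apply.
    rewrite (_ : [seq _ <- _ | _] = [:: cap J]) ?big_seq1 //.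
    rewrite -(filter_pred1_uniq (fset_uniq _) JP); apply: eq_filter => Z /=.
    by rewrite [RHS]eq_sym; case: eqP => [<-|]; rewrite ?andbF ?YJ.
  by rewrite big_filter big_pred0 // => Z; case: eqP => [<-|]; rewrite ?andbF ?YJ.
rewrite sum_sign_subsets; congr (_%:R); congr nat_of_bool.
apply/eqP/eqP => [D0|YT].
  rewrite def_Y (_ : J0 = finset.set0) ?cap0 //.
  by apply/eqP; rewrite -finset.subset0 -D0 subD def_Y; apply/asboolP.
apply/setP=> i; rewrite !finset.inE; apply/asboolP; rewrite YT => sub.
by apply: (HnT i); apply/seteqP.
Qed.

(** Each [J] with nonempty intersection is counted once, under the flat [cap J]. *)
Lemma whitney : (forall i, H i <> setT) ->
  char_poly_arr hyps =
  \sum_(J : {set I}) (-1) ^+ #|J| *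
     (if `[< (cap J !=set0)%classic >] then 'X^(affdim (cap J)) else 0).
Proof.
move=> HnT; rewrite /char_poly_arr big_seq_cond.
under eq_bigr => X /andP[XP _] do rewrite mobius_hyps // rmorph_sum mulr_suml.
rewrite (exchange_big_dep xpredT) //=; apply: eq_bigr => J _.
case: asboolP => ne0.
  have JP : cap J \in intersection_poset hyps.
    by apply/in_intersection_poset; split; last exists J.
  under eq_bigl => X do rewrite andbT.
  rewrite -big_filter (_ : [seq _ <- _ | _] = [:: cap J]) ?big_seq1.
    by rewrite rmorphXn rmorphN1.
  rewrite -(filter_pred1_uniq (fset_uniq _) JP); apply: eq_in_filter => Z /= ->.
  by rewrite eq_sym.
rewrite mulr0 big_pred0 // => X; apply/negP => /andP[/andP[XP _] /eqP eqX].
by case/in_intersection_poset: XP; rewrite -eqX => /ne0.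
Qed.

End Whitney.

(** * Linear systems modulo large primes *)

Lemma rank_pid_mx_min (K : fieldType) m n r :
  \rank (pid_mx r : 'M[K]_(m, n)) = minn m (minn n r).
Proof.
rewrite -pid_mx_minh -pid_mx_minv rank_pid_mx //; first exact: geq_minl.
by apply: leq_trans (geq_minr _ _) (geq_minl _ _).
Qed.

(* The Smith normal form over the integers reduces in every field in which its
   nonzero diagonal entries stay nonzero. *)
Lemma rank_int_mx m n (M : 'M[int]_(m, n)) :
  exists r (p0 : nat), forall K : fieldType,
    (forall d : int, d != 0 -> (`|d| <= p0)%N -> d%:~R != 0 :> K) ->
    \rank (map_mx intr M : 'M[K]_(m, n)) = r.
Proof.
have [L uL [U uU [d sd ->]]] := int_Smith_normal_form M.
pose r := index 0 d; exists (minn m (minn n r)), (\max_(x <- d) `|x|)%N => K Knz.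
have unit_map k (A : 'M[int]_k) : A \in unitmx -> map_mx intr A \in @unitmx K k.
  by rewrite !unitmxE det_map_mx; apply: rmorph_unit.
rewrite !map_mxM mxrankMfree ?row_free_unit ?unit_map // (eqmxMfull _ _); last first.
  by rewrite row_full_unit unit_map.
(* Each entry divides the later ones, so zeros come last and [r] counts the nonzero entries. *)
have dE i : (d`_i == 0) = (r <= i)%N.
  case: (ltnP i r) => [lt_ir|le_ri].
    by have := before_find 0 lt_ir => /= ->.
  case: (ltnP i (size d)) => [lti|/(nth_default 0)->]; last by rewrite eqxx.
  have r0 : d`_r = 0 by apply: nth_index; rewrite -index_mem (leq_ltn_trans le_ri).
  have := sorted_leq_nth (fun y x z => @dvdz_trans y x z) dvdzz 0 sd r i.
  rewrite !inE lti (leq_ltn_trans le_ri lti) r0 => /(_ isT isT le_ri).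
  by rewrite dvd0z.
(* Replacing the entries from [r] on by 1 makes the diagonal factor invertible; [pid_mx r] carries
   the rank. *)
pose u : 'rV[K]_m := \row_i (if (i < r)%N then (d`_i)%:~R else 1).
have -> : map_mx intr (\matrix_(i, j) (d`_i *+ (i == j :> nat))) =
          diag_mx u *m pid_mx r :> 'M[K]_(m, n).
  rewrite mul_diag_mx; apply/matrixP=> i j; rewrite !mxE.
  case: (i == j :> nat); last by rewrite !mulr0n mulr0.
  rewrite mulr1n /=; have := dE i; case: ltnP => _; first by rewrite mulr1.
  by move/eqP->; rewrite mulr0.
rewrite (eqmxMfull _ _) ?rank_pid_mx_min // row_full_unit unitmxE det_diag unitfE.
apply/prodf_neq0 => i _; rewrite mxE; case: ltnP => [lti|_]; last exact: oner_neq0.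
have di : d`_i != 0 by rewrite dE -ltnNge.
apply: Knz => //; have szi : (i < size d)%N.
  by rewrite ltnNge; apply: contra di => /(nth_default 0)->.
by rewrite (big_rem _ (mem_nth 0 szi)) /= leq_maxl.
Qed.

Lemma Fp_intr_eq0 p (d : int) : prime p -> d != 0 -> (`|d| < p)%N ->
  d%:~R != 0 :> 'F_p.
Proof.
move=> pr_p d0 ltp; rewrite -(dvdz_pcharf (pchar_Fp pr_p)) dvdzE /=.
by apply/negP => /dvdn_leq; rewrite absz_gt0 leqNgt ltp => /(_ d0).
Qed.

Lemma rank_int_mx_Fp (R : realType) m n (M : 'M[int]_(m, n)) :
  exists p0, forall p, prime p -> (p0 < p)%N ->
    \rank (map_mx intr M : 'M['F_p]_(m, n)) = \rank (map_mx intr M : 'M[R]_(m, n)).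
Proof.
have [r [p0 rE]] := rank_int_mx M; exists p0 => p pr_p ltp.
rewrite !rE // => d d0; first by rewrite intr_eq0.
by move=> led; apply: Fp_intr_eq0 => //; apply: leq_ltn_trans ltp.
Qed.

(** Solvability becomes an equality of ranks, which survives reduction modulo a large prime. *)
Lemma submx_rank (K : fieldType) n m (M : 'M[K]_(n, m)) (c : 'rV[K]_m) :
  (c <= M)%MS = (\rank (col_mx M c) == \rank M).
Proof.
have sub : (M <= col_mx M c)%MS by rewrite -addsmxE addsmxSl.
rewrite eq_sym (mxrank_leqif_sup sub) -addsmxE.
by rewrite addsmx_sub submx_refl.
Qed.

(** A nonempty solution set is a coset of the left kernel of [M]. *)
Lemma card_solutions (K : finFieldType) n m (M : 'M[K]_(n, m)) (c : 'rV[K]_m) :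
  #|[set v : 'rV[K]_n | v *m M == c]| =
  if (c <= M)%MS then (#|K| ^ (n - \rank M))%N else 0%N.
Proof.
case: ifP => [/submxP[x def_c]|nsol]; last first.
  apply/eqP; rewrite cards_eq0; apply/eqP/setP=> v; rewrite !finset.inE.
  by apply: contraFF nsol => /eqP <-; apply: submxMl.
rewrite -mxrank_ker -card_rowg -[RHS](card_imset _ (addrI x)).
apply: eq_card => v; rewrite finset.inE; apply/eqP/imsetP => [vM|[w]].
  exists (v - x); last by rewrite addrC subrK.
  by rewrite mem_rowg sub_kermx mulmxBl vM def_c subrr.
by rewrite mem_rowg sub_kermx def_c => /eqP w0 ->; rewrite mulmxDl w0 addr0.
Qed.

(** Links kernels given as matrices to the vector spaces in which [affdim] is expressed. *)
Lemma rowspace_vspace (K : fieldType) n m (A : 'M[K]_(m, n)) :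
  exists2 U : {vspace 'rV[K]_n}, (forall u, (u \in U) = (u <= A)%MS)
    & \dim U = \rank A.
Proof.
pose B := row_base A; pose X := [tuple row i B | i < \rank A].
have XE (i : 'I_(\rank A)) : X`_i = row i B by rewrite -tnth_nth tnth_mktuple.
exists <<X>>%VS => [u|].
  transitivity (u <= B)%MS; last by rewrite eq_row_base.
  apply/idP/submxP => [/coord_span->|[k ->]].
    exists (\row_i coord X i u); rewrite mulmx_sum_row; apply: eq_bigr => i _.
    by rewrite mxE XE.
  rewrite mulmx_sum_row; apply: memv_suml => i _; apply/memvZ/memv_span.
  by rewrite -XE mem_nth // size_tuple.
suff /eqnP -> : free X by rewrite size_tuple.
apply/freeP => k k0 i; suff /(row_free_inj (row_base_free A))/rowP/(_ i) :
    (\row_j k j) *m B = 0 *m B by rewrite !mxE.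
by rewrite mul0mx mulmx_sum_row -[RHS]k0; apply: eq_bigr => j _; rewrite mxE XE.
Qed.

Lemma affdim_solutions (R : realType) n m (M : 'M[R]_(n, m)) (c : 'rV[R]_m) :
  let X := [set v | v *m M = c]%classic in
  `[< (X !=set0)%classic >] = (c <= M)%MS /\
  ((X !=set0)%classic -> affdim X = (n - \rank M)%N).
Proof.
split.
  apply/asboolP/submxP => [[v vM]|[v vM]]; first by exists v; rewrite vM.
  by exists v; rewrite /= vM.
case=> x xM; have [U memU] := rowspace_vspace (kermx M).
rewrite mxrank_ker => <-; rewrite -(affdim_translate x U); congr affdim.
apply/seteqP; split=> v /=; rewrite /translate /= memU sub_kermx mulmxBl xM.
  by move=> ->; rewrite subrr.
by rewrite subr_eq0 => /eqP.
Qed.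

(** * Counting points off an integral arrangement *)

Section FiniteField.
Variables (R : realType) (n : nat) (I : finType).
Variables (a : I -> 'rV[int]_n) (c : I -> int).

Definition point_mod p (i : I) (v : 'rV['F_p]_n) : bool :=
  \sum_k v 0 k * (a i 0 k)%:~R == (c i)%:~R.

Definition int_hyperplane (i : I) : set 'rV[R]_n :=
  hyperplane (map_mx intr (a i)) (c i)%:~R.

(** Solvability and dimension depend only on the ranks of the coefficient matrix [M] and of the
    augmented matrix [col_mx M d], and both ranks agree over [R] and ['F_p] for large [p]. *)
Lemma card_cap_mod (J : {set I}) : exists p0, forall p, prime p -> (p0 < p)%N ->
  #|[set v | [forall i in J, point_mod i (v : 'rV['F_p]_n)]]| =
  if `[< (cap int_hyperplane J !=set0)%classic >]
  then (p ^ affdim (cap int_hyperplane J))%N else 0%N.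
Proof.
pose M := \matrix_(k < n, j < #|J|) a (enum_val j) 0 k.
pose d := \row_(j < #|J|) c (enum_val j).
have [p1 rk1] := rank_int_mx_Fp R M; have [p2 rk2] := rank_int_mx_Fp R (col_mx M d).
have mulE (K : fieldType) (v : 'rV[K]_n) : v *m map_mx intr M = map_mx intr d <->
    forall i, i \in J -> \sum_k v 0 k * (a i 0 k)%:~R = (c i)%:~R.
  split=> [/rowP eqv i iJ|eqv].
    have := eqv (enum_rank_in iJ i); rewrite !mxE enum_rankK_in // => <-.
    by apply: eq_bigr => k _; rewrite !mxE enum_rankK_in.
  apply/rowP=> j; rewrite !mxE -(eqv _ (enum_valP j)).
  by apply: eq_bigr => k _; rewrite !mxE.
exists (maxn p1 p2) => p pr_p; rewrite gtn_max => /andP[ltp1 ltp2].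
have -> : cap int_hyperplane J =
    [set v | v *m map_mx intr M = map_mx intr d]%classic.
  apply/seteqP; split=> v /=.
    move=> vJ; apply/mulE => i /vJ; rewrite /int_hyperplane /hyperplane /inner /= => <-.
    by apply: eq_bigr => k _; rewrite mxE.
  move/mulE=> vJ i /vJ; rewrite /int_hyperplane /hyperplane /inner /= => <-.
  by apply: eq_bigr => k _; rewrite mxE.
have [-> dimE] := affdim_solutions (map_mx intr M : 'M[R]_(n, _)) (map_mx intr d).
rewrite submx_rank -map_col_mx -(rk1 p) // -(rk2 p) // map_col_mx -submx_rank.
have -> : [set v | [forall i in J, point_mod i v]] =
          [set v : 'rV['F_p]_n | v *m map_mx intr M == map_mx intr d].
  apply/setP=> v; rewrite !finset.inE; apply/forall_inP/eqP => [vJ|/mulE vJ i /vJ/eqP//].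
  by apply/mulE => i /vJ/eqP.
rewrite card_solutions; case: ifP => // sol.
rewrite card_Fp // dimE ?rk1 //; apply/asboolP.
have [-> _] := affdim_solutions (map_mx intr M : 'M[R]_(n, _)) (map_mx intr d).
by rewrite submx_rank -map_col_mx -(rk1 p) // -(rk2 p) // map_col_mx -submx_rank.
Qed.

(** Evaluated at a large prime, Whitney's sum becomes inclusion-exclusion for the points of ['F_p^n]
    on none of the reduced hyperplanes. *)
Theorem finite_field_method : (forall i, a i != 0) ->
  exists p0, forall p, prime p -> (p0 < p)%N ->
  (char_poly_arr (hyps int_hyperplane)).[p%:R] =
  #|[set v : 'rV['F_p]_n | [forall i, ~~ point_mod i v]]|%:R.
Proof.
move=> a_neq0; have [q qP] := fin_all_exists card_cap_mod.
exists (\max_J q J)%N => p pr_p ltp; rewrite whitney; last first.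
  (* If the hyperplane were the whole space, containing 0 would give [c i = 0], and containing the
     unit vectors would then give [a i = 0]. *)
  move=> i /seteqP[_ sub]; have /eqP[] := a_neq0 i; apply/rowP=> k.
  have c0 : (c i)%:~R = 0 :> R.
    by rewrite -(sub 0 Logic.I) /inner big1 // => j _; rewrite mxE mul0r.
  have := sub (delta_mx 0 k) Logic.I; rewrite /int_hyperplane /hyperplane /= /inner.
  rewrite c0 (bigD1 k) //= big1 => [|j jk].
    by rewrite !mxE !eqxx mul1r addr0 => /eqP; rewrite intr_eq0 => /eqP.
  by rewrite mxE eqxx (negbTE jk) mul0r.
rewrite horner_sum.
transitivity (\sum_(J : {set I}) (-1) ^+ #|J| *
    #|[set v | [forall i in J, point_mod i (v : 'rV['F_p]_n)]]|%:R : int).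
  apply: eq_bigr => J _; rewrite qP //; last first.
    by apply: leq_ltn_trans ltp; apply: leq_bigmax.
  rewrite hornerM horner_exp hornerN hornerC; congr (_ * _).
  by case: ifP => _; rewrite ?horner0 // hornerXn natrX.
pose D v := [set i | point_mod i (v : 'rV['F_p]_n)].
transitivity (\sum_(v : 'rV['F_p]_n) \sum_(J : {set I} | J \subset D v) (-1) ^+ #|J| : int).
  rewrite (exchange_big_dep xpredT) //=; apply: eq_bigr => J _.
  rewrite -[X in _ * X%:R]sum1_card natr_sum mulr_sumr.
  apply: eq_big => [v|v _]; last by rewrite mulr1.
  rewrite finset.inE; apply/forall_inP/fintype.subsetP => vJ i /vJ; by rewrite finset.inE.
rewrite -sum1_card natr_sum [RHS]big_mkcond; apply: eq_bigr => v _.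
rewrite sum_sign_subsets finset.inE -[RHS]mulrb; congr (_%:R); congr nat_of_bool.
apply/eqP/forallP => [D0 i|vD].
  by apply: contraFN (finset.in_set0 i) => vi; rewrite -D0 finset.inE.
by apply/setP=> i; rewrite !finset.inE; apply/negbTE.
Qed.

End FiniteField.

(** * Roots of type B and C *)

Section RootVectors.
Variables (T : BCtype) (n : nat).
Implicit Types (e f g : code n).

(** Taken over any ring, so that the real roots are images of integer vectors, as the finite field
    method requires. *)
Definition root_vec (K : pzRingType) e : 'rV[K]_n :=
  let: (i, j, s) := e in
  if i == j then
    match T with TypeB => delta_mx 0 i | TypeC => delta_mx 0 i *+ 2 end
  else delta_mx 0 i + (-1) ^+ s *: delta_mx 0 j.

Lemma root_vecE (K : pzRingType) i j s x : root_vec K (i, j, s) 0 x =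
  if i == j then
    match T with TypeB => (x == i)%:R | TypeC => (x == i)%:R *+ 2 end
  else (x == i)%:R + (-1) ^+ s * (x == j)%:R.
Proof.
rewrite /root_vec; case: (i == j); last by rewrite !mxE.
by case: T; rewrite ?mulr2n !mxE.
Qed.

Lemma map_root_vec (K : pzRingType) e : map_mx intr (root_vec int e) = root_vec K e.
Proof.
case: e => [[i j] s]; apply/rowP=> x; rewrite mxE !root_vecE.
have boolE (b : bool) : (b%:R : int)%:~R = b%:R :> K by case: b.
case: (i == j); first by case: T; rewrite ?mulr2n ?intrD boolE.
by rewrite intrD intrM !boolE; case: s.
Qed.

Lemma root_vec_inj : {in @valid n &, injective (root_vec int)}.
Proof.
move=> [[i j] s] [[k l] r]; rewrite /in_mem /= /valid /= => ve vf /rowP eq_ef.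
suff /and3P[/eqP -> /eqP -> /eqP ->] : [&& i == k, j == l & s == r] by [].
have := eq_ef i; have := eq_ef j; have := eq_ef k; have := eq_ef l.
rewrite !root_vecE -!val_eqE /=; move: ve vf; rewrite -!val_eqE /=; clear eq_ef.
case: (i =P j :> nat) => eqij; case: (k =P l :> nat) => eqkl;
  by case: T s r => -[] [] /=; rewrite ?expr0 ?expr1 ?mulN1r ?mul1r ?mulr2n; lia.
Qed.

Definition root_diff e f : Prop :=
  exists g (m : int), [/\ valid g, m != 0
    & root_vec int e - root_vec int f = m *: root_vec int g].

Lemma root_diff_sym e f : root_diff e f -> root_diff f e.
Proof.
by case=> g [m [vg m0 eqm]]; exists g, (- m); rewrite oppr_eq0 scaleNr -eqm opprB.
Qed.

(** Each kind of conflict has an explicit difference; the multiple, and sometimes the root, depends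
    on whether the axis root is [e_i] or [2 e_i]. *)
Lemma conflict_root_diff e f : valid e -> valid f -> conflict e f -> root_diff e f.
Proof.
have val_neq (i j : 'I_n) : (i < j)%N -> (i == j) = false.
  by move=> lt; apply/negbTE; rewrite neq_ltn lt.
have diag (i : 'I_n) : valid (i, i, false) by rewrite /valid /= eqxx orbT.
have same (i j l : 'I_n) s r : (i < j)%N -> (j <= l)%N -> (j, s) != (l, r) ->
    root_diff (i, j, s) (i, l, r).
  move=> ltij; rewrite leq_eqVlt => /orP[/eqP/val_inj <-|ltjl _].
    rewrite xpair_eqE eqxx /= => ne.
    (* Here [s] and [r] differ, so the difference is [2 e_j] up to sign: twice the axis root in type
       B, once in type C. *)
    exists (j, j, false), (match T with TypeB => 2 | TypeC => 1 end * (-1) ^+ s).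
    split=> //; first by case: T s {ne} => -[].
    apply/rowP=> x; rewrite !mxE !root_vecE (val_neq _ _ ltij) eqxx.
    by case: T s r ne => -[] [] //= _; ring.
  exists (j, l, ~~ (s (+) r)), ((-1) ^+ s); split; first by rewrite /valid /= ltjl.
    by case: s.
  apply/rowP=> x; rewrite !mxE !root_vecE (val_neq _ _ ltij) (val_neq _ _ ltjl).
  by rewrite (val_neq _ _ (ltn_trans ltij ltjl)); case: s r => -[] /=; ring.
have axis (i j : 'I_n) s : (i < j)%N -> root_diff (i, i, false) (i, j, s).
  move=> ltij; case ET: T.
    exists (j, j, false), (- (-1) ^+ s); split=> //; first by case: s.
    apply/rowP=> x; rewrite !mxE !root_vecE (val_neq _ _ ltij) !eqxx ET.
    by case: s => /=; ring.
  exists (i, j, ~~ s), 1; split=> //; first by rewrite /valid /= ltij.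
  apply/rowP=> x; rewrite !mxE !root_vecE (val_neq _ _ ltij) !eqxx ET.
  by case: s => /=; ring.
have axes (i j : 'I_n) : (i < j)%N -> root_diff (i, i, false) (j, j, false).
  move=> ltij; exists (i, j, true), (match T with TypeB => 1 | TypeC => 2 end).
  split=> //; [by rewrite /valid /= ltij | by case: T |].
  apply/rowP=> x; rewrite !mxE !root_vecE (val_neq _ _ ltij) !eqxx.
  by case: T => /=; ring.
have last (i k j : 'I_n) s : (i < k)%N -> (k < j)%N -> root_diff (i, j, s) (k, j, s).
  move=> ltik ltkj; exists (i, k, true), 1; split=> //; first by rewrite /valid /= ltik.
  apply/rowP=> x; rewrite !mxE !root_vecE (val_neq _ _ ltik) (val_neq _ _ ltkj).
  rewrite (val_neq _ _ (ltn_trans ltik ltkj)).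
  by case: s => /=; ring.
have chain (i j l : 'I_n) r : (i < j)%N -> (j < l)%N ->
    root_diff (i, j, false) (j, l, r).
  move=> ltij ltjl; exists (i, l, ~~ r), 1; split=> //.
    by rewrite /valid /= (ltn_trans ltij).
  apply/rowP=> x; rewrite !mxE !root_vecE (val_neq _ _ ltij) (val_neq _ _ ltjl).
  rewrite (val_neq _ _ (ltn_trans ltij ltjl)).
  by case: r => /=; ring.
(* The difference is [e_i] in type B and [e_i - e_j] in type C. *)
have chain0 (i j : 'I_n) : (i < j)%N -> root_diff (i, j, false) (j, j, false).
  move=> ltij; case ET: T.
    exists (i, i, false), 1; split=> //.
    apply/rowP=> x; rewrite !mxE !root_vecE (val_neq _ _ ltij) !eqxx ET /=; ring.
  exists (i, j, true), 1; split=> //; first by rewrite /valid /= ltij.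
  apply/rowP=> x; rewrite !mxE !root_vecE (val_neq _ _ ltij) !eqxx ET /=; ring.
case: e f => [[i j] s] [[k l] r]; rewrite {1 2}/valid /conflict /=.
move=> ve vf /andP[ne]; move: ve vf ne.
move=> /orP[ltij|/andP[/eqP <-{j} /negbTE->]] /orP[ltkl|/andP[/eqP <-{l} /negbTE->]].
- rewrite (val_neq _ _ ltij) ltij /=.
  case: (eqVneq i k) => [eqik|neq] ne /=.
    rewrite -{k}eqik in ltkl ne * => _; case: (leqP j l) => [lejl|/ltnW lelj].
      by apply: same => //; move: ne; rewrite !xpair_eqE eqxx.
    by apply/root_diff_sym/same => //; move: ne; rewrite eq_sym !xpair_eqE eqxx.
  move=> /orP[/andP[/eqP eqkj /negbTE s0]|/andP[/eqP eqlj /eqP eqrs]].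
    by rewrite s0 -eqkj in ltij *; apply: chain.
  rewrite eqlj eqrs in ltkl *.
  case: (ltngtP i k) neq => [lt|lt|/val_inj->] neq; last by rewrite eqxx in neq.
    exact: last.
  exact/root_diff_sym/last.
- rewrite (val_neq _ _ ltij) ltij /=.
  case: (eqVneq i k) => [eqik|neq] ne /=.
    by rewrite -eqik => _; apply/root_diff_sym/axis.
  case: (eqVneq k j) => //= -> /orP[/negbTE->|/eqP<-]; exact: chain0.
- rewrite (val_neq _ _ ltkl) ltnn andbF /= orbF => _ /eqP ->.
  exact: axis.
- move=> ne _; case: (ltngtP i k) ne => [lt|lt|/val_inj->] ne.
  + exact: axes.
  + exact/root_diff_sym/axes.
  + by rewrite eqxx in ne.
Qed.

End RootVectors.

Section Pairing.
Variables (T : BCtype) (n : nat) (K : comNzRingType).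
Implicit Types (v : 'rV[K]_n) (a b : 'rV[int]_n).

Definition pairing v a : K := \sum_k v 0 k * (a 0 k)%:~R.

Lemma pairingB v a b : pairing v (a - b) = pairing v a - pairing v b.
Proof. by rewrite /pairing -sumrB; apply: eq_bigr => k _; rewrite !mxE intrB mulrBr. Qed.

Lemma pairingZ v m a : pairing v (m *: a) = m%:~R * pairing v a.
Proof. by rewrite /pairing mulr_sumr; apply: eq_bigr => k _; rewrite !mxE intrM mulrCA. Qed.

Lemma pairing_root v i j s : pairing v (root_vec T int (i, j, s)) =
  if i == j then match T with TypeB => v 0 i | TypeC => v 0 i *+ 2 end
  else v 0 i + (-1) ^+ s * v 0 j.
Proof.
have sum1 k : \sum_x v 0 x * (x == k)%:R = v 0 k.
  rewrite (bigD1 k) //= eqxx mulr1 big1 ?addr0 // => x /negbTE->.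
  by rewrite mulr0.
have boolE (b : bool) : (b%:R : int)%:~R = b%:R :> K by case: b.
rewrite /pairing; under eq_bigr => x _ do rewrite root_vecE.
case: (i == j); first case: T.
- by under eq_bigr => x _ do rewrite boolE; rewrite sum1.
- under eq_bigr => x _ do rewrite mulr2n intrD boolE -mulr2n mulrnAr.
  by rewrite sumrMnl sum1.
under eq_bigr => x _ do rewrite intrD intrM !boolE mulrDr mulrCA.
rewrite big_split /= sum1 -mulr_sumr sum1; congr (_ + _ * _).
by case: s.
Qed.

End Pairing.

(** * Points modulo [p = 2N + 1] as signed positions *)

Section OddPrime.
Variables (T : BCtype) (n N p : nat).
Hypotheses (pr_p : prime p) (def_p : p = N.*2.+1).
Implicit Types (S : {set code n}) (v : 'rV['F_p]_n).

(** The complement of [Cox] modulo [p]. *)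
Definition regular v : bool :=
  [forall e, valid e ==> (pairing v (root_vec T int e) != 0)].

Definition solutions S : {set 'rV['F_p]_n} :=
  [set v | regular v & [forall e in S, pairing v (root_vec T int e) == 1]].

(** Representatives of least absolute value for the nonzero residues modulo [p]. *)
Definition signed (x : bool * 'I_N) : int := if x.1 then - (x.2.+1)%:Z else x.2.+1%:Z.

Definition point_of (c : config n N) : 'rV['F_p]_n := \row_i (signed (c i))%:~R.

Lemma intr_Fp_eq0 (z : int) : (`|z| < p)%N -> (z%:~R == 0 :> 'F_p) = (z == 0).
Proof.
move=> ltz; case: (eqVneq z 0) => [->|z0]; first by rewrite eqxx.
exact/negbTE/Fp_intr_eq0.
Qed.

Lemma signed_bounds x : (1 <= `|signed x| <= N)%N.
Proof. by case: x => -[] y; rewrite /signed /=; have := ltn_ord y; lia. Qed.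

Lemma signed_inj : injective signed.
Proof.
move=> [[] x] [[] y]; rewrite /signed /= => eqz; try lia.
  by congr (_, _); apply/val_inj => /=; lia.
by congr (_, _); apply/val_inj => /=; lia.
Qed.

Lemma intr_signed_inj : injective (fun x => (signed x)%:~R : 'F_p).
Proof.
move=> x y /eqP; rewrite -subr_eq0 -intrB intr_Fp_eq0; last first.
  by have := signed_bounds x; have := signed_bounds y; lia.
by rewrite subr_eq0 => /eqP/signed_inj.
Qed.

Lemma intr_signed_onto (u : 'F_p) : u != 0 -> exists x, u = (signed x)%:~R.
Proof.
move=> u0; have ltu : (u < p)%N by rewrite -[ltnRHS](Fp_cast pr_p) ltn_ord.
have u_gt0 : (0 < u)%N by rewrite lt0n; apply: contra u0 => /eqP u0; apply/eqP/val_inj.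
case: (leqP u N) => [leuN|ltNu].
  have lt : (u.-1 < N)%N by lia.
  exists (false, Ordinal lt); rewrite /signed /= prednK //.
  by rewrite -[LHS]natr_Zp pmulrn.
have lt : ((p - u).-1 < N)%N by lia.
exists (true, Ordinal lt); rewrite /signed /= prednK; last by lia.
rewrite -(subzn (ltnW ltu)) intrN intrB -pmulrn pchar_Fp_0 // sub0r opprK.
by rewrite -pmulrn natr_Zp.
Qed.

Lemma point_of_inj : injective point_of.
Proof.
move=> c d /rowP eq_cd; apply/ffunP=> i; apply: intr_signed_inj.
by have := eq_cd i; rewrite !mxE.
Qed.

Lemma signed_neq (c : config n N) i j : injective (fun i => (c i).2) -> i != j ->
  `|signed (c i)|%N != `|signed (c j)|%N.
Proof.
move=> inj; apply: contra => /eqP eqz; apply/eqP/inj/val_inj.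
by move: eqz; rewrite /signed; case: (c i) (c j) => [[] x] [[] y] /=; lia.
Qed.

(** An integer lift of the pairing, of absolute value at most [2N < p], so its vanishing modulo [p]
    is decided over the integers. *)
Definition int_form (c : config n N) (e : code n) : int :=
  let: (i, j, s) := e in
  if i == j then
    match T with TypeB => signed (c i) | TypeC => signed (c i) * 2 end
  else signed (c i) + (if s then - signed (c j) else signed (c j)).

Lemma pairing_point c e :
  pairing (point_of c) (root_vec T int e) = (int_form c e)%:~R.
Proof.
case: e => [[i j] s]; rewrite pairing_root /= !mxE.
case: (i == j); first by case: T => //; rewrite intrM mulr_natr.
by case: s; rewrite ?expr0 ?expr1 ?mul1r ?mulN1r intrD ?intrN.
Qed.

Lemma regular_point (c : config n N) : injective (fun i => (c i).2) -> regular (point_of c).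
Proof.
move=> inj; apply/forall_inP=> -[[i j] s] _; rewrite pairing_point.
have bi := signed_bounds (c i); have bj := signed_bounds (c j).
rewrite intr_Fp_eq0 /=; case: (eqVneq i j) => [_|/(signed_neq inj)];
  by case: T => //; try case: s; lia.
Qed.

(** The integer form minus 1 is smaller than [p] in absolute value, except when [2 x_i - 1 = -p];
    this exception is the solution [x_i = -N] in type C. *)
Lemma sat_point (c : config n N) e : injective (fun i => (c i).2) ->
  (pairing (point_of c) (root_vec T int e) == 1) = sat T c e.
Proof.
move=> inj; rewrite pairing_point -subr_eq0 -(intrB _ _ 1).
case: e => [[i j] s]; have bi := signed_bounds (c i); have bj := signed_bounds (c j).
rewrite /=; case: (eqVneq i j) => [_|/(signed_neq inj) ne].
  case: T.
    rewrite intr_Fp_eq0; last by lia.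
    by rewrite /signed; case: (c i) => -[] x /=; lia.
  rewrite -(dvdz_pcharf (pchar_Fp pr_p)) dvdzE /=.
  have lt := ltn_ord (c i).2.
  apply/idP/idP => [/dvdn_leq|].
    by move: bi lt; rewrite /signed; case: (c i) => -[] x /=; lia.
  move=> /andP[c1 /eqP c2]; rewrite (_ : absz _ = p) //.
  by rewrite /signed c1; lia.
rewrite intr_Fp_eq0; last by case: s; lia.
by move: ne; rewrite /signed; case: (c i) (c j) s => [[] x] [[] y] [] /=; lia.
Qed.

(** The axis roots make every coordinate nonzero, and the roots [e_i - e_j] and [e_i + e_j] exclude
    equal absolute values. *)
Lemma regular_pointP v : regular v ->
  exists2 c : config n N, injective (fun i => (c i).2) & v = point_of c.
Proof.
move=> /forall_inP reg.
have v_neq0 i : v 0 i != 0.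
  have := reg (i, i, false); rewrite pairing_root /valid /= eqxx orbT => /(_ isT).
  by case: T => //; apply: contra => /eqP->; rewrite mul0rn.
have /fin_all_exists[c cP] i : exists x, v 0 i = (signed x)%:~R.
  exact: intr_signed_onto.
have vE : v = point_of [ffun i => c i].
  by apply/rowP=> i; rewrite mxE ffunE cP.
exists [ffun i => c i] => //.
suff inj (i j : 'I_n) : (i < j)%N -> (c i).2 != (c j).2.
  move=> i j; rewrite !ffunE => eqij; apply/eqP/negPn/negP.
  by rewrite neq_ltn => /orP[/inj|/inj]; rewrite eqij eqxx.
move=> ltij; apply/eqP=> eqij.
(* The sign is chosen so that equal absolute values cancel in the pairing. *)
have ve : valid (i, j, (c i).1 == (c j).1) by rewrite /valid /= ltij.
have := reg _ ve; rewrite vE pairing_point /= !ffunE; case: (i =P j) => [eq_ij|_].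
  by rewrite eq_ij ltnn in ltij.
move: eqij; rewrite /signed; case: (c i) (c j) => [[] x] [[] y] /= ->;
  by rewrite ?subrr ?addrN ?addNr eqxx.
Qed.

Lemma card_solutions_sat S : #|solutions S| = #|placements T N S|.
Proof.
rewrite -(card_imset _ point_of_inj); apply: eq_card => v.
apply/idP/imsetP => [|[c]].
  rewrite finset.inE => /andP[/regular_pointP[c inj ->] /forall_inP vS].
  exists c => //; rewrite finset.inE; apply/andP; split; first exact/injectiveP.
  by apply/forall_inP=> e /vS; rewrite sat_point.
rewrite finset.inE => /andP[/injectiveP inj /forall_inP cS] ->.
rewrite finset.inE regular_point //=; apply/forall_inP=> e /cS.
by rewrite sat_point.
Qed.

(** Subtracting the two equations gives [m (v, g) = 0]. Since [m] is nonzero modulo [p], the point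
    lies on a hyperplane of [Cox]. *)
Lemma solutions_root_diff S e f : (4 < p)%N -> e \in S -> f \in S ->
  root_diff T e f -> solutions S = finset.set0.
Proof.
clear def_p; move=> p_gt4 eS fS [g [m [vg m0 eq_m]]]; apply/setP=> v; rewrite !finset.inE.
apply/negP => /andP[/forall_inP reg /forall_inP vS].
have := reg g vg; apply/negP; rewrite negbK.
have : m%:~R * pairing v (root_vec T int g) == 0.
  by rewrite -pairingZ -eq_m pairingB (eqP (vS _ eS)) (eqP (vS _ fS)) subrr.
rewrite mulf_eq0 intr_Fp_eq0 ?(negbTE m0) //; apply: leq_ltn_trans p_gt4.
(* Root coordinates are at most 2 in absolute value and coordinate [i] of [g] is nonzero, whence
   [|m| <= 4 < p]. *)
have bound (h : code n) x : (`|root_vec T int h 0%R x| <= 2)%N.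
  case: h => [[i j] s]; rewrite root_vecE.
  case: (eqVneq i j) => [_|ne]; first by case: T; case: eqP.
  by case: s; case: (x =P i) => [->|_]; rewrite ?(negbTE ne) //; case: eqP.
case: g vg eq_m => [[i j] s] _ /rowP/(_ i); rewrite !mxE [in RHS]root_vecE eqxx.
move: (bound e i) (bound f i); move: (root_vec T int e 0 i) (root_vec T int f 0 i).
move=> /= x y bx byy; case: (eqVneq i j) => [_|_] eqm.
  by case: T eqm => /=; rewrite ?mulr2n ?mulrDr mulr1 => eqm; lia.
by move: eqm; rewrite mulr0 addr0 mulr1 => eqm; lia.
Qed.

End OddPrime.

Lemma card_fset_image (I : finType) (K : choiceType) (f : I -> K) (A : {set I}) :
  {in A &, injective f} -> #|` [fset f x | x in A]%fset| = #|A|.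
Proof.
by move=> inj; rewrite card_in_imfset // cardE.
Qed.

Lemma poly_int_eq_cofinal (P Q : {poly int}) :
  (forall m, exists2 x : nat, (m < x)%N & P.[x%:R] = Q.[x%:R]) -> P = Q.
Proof.
move=> PQ; apply/eqP; rewrite -subr_eq0; apply/negPn/negP => neq.
have [s [us ss rs]] : exists s : seq nat,
    [/\ uniq s, size s = size (P - Q)
      & all (fun x : nat => root (P - Q) x%:R) s].
  elim: (size _) => [|k [s [us ss rs]]]; first by exists [::].
  (* An agreement point beyond all earlier ones is a new root of [P - Q]. *)
  have [x ltx eqx] := PQ (\max_(y <- s) y)%N; exists (x :: s); split=> //=.
  - rewrite us andbT; apply/negP => xs.
    by move: ltx; rewrite (big_rem _ xs) /= ltnNge leq_maxl.
  - by rewrite ss.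
  - by rewrite rs rootE hornerD hornerN eqx subrr eqxx.
have := max_poly_roots neq (rs := [seq (x%:R : int) | x <- s]).
rewrite all_map rs map_inj_uniq ?us; last by move=> x y /eqP; rewrite eqr_nat => /eqP.
by rewrite size_map ss ltnn => /(_ isT isT).
Qed.

(** * Quasi-antichains as sets of codes *)

Section Roots.
Variables (R : realType) (n : nat) (T : BCtype).
Implicit Types (S : {set code n}) (e f : code n).

Lemma pos_rootsP a :
  reflect (exists2 e, valid e & a = root_vec T R e) (a \in pos_roots R n T).
Proof.
apply: (iffP idP).
  rewrite !inE => /orP[/orP[]|] /imfsetP[/=].
  - move=> [i j] /=; rewrite inE /= => ltij ->; exists (i, j, false).
      by rewrite /valid /= ltij.
    by rewrite /root_vec ifN ?neq_ltn ?ltij // scale1r.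
  - move=> [i j] /=; rewrite inE /= => ltij ->; exists (i, j, true).
      by rewrite /valid /= ltij.
    by rewrite /root_vec ifN ?neq_ltn ?ltij // expr1 scaleN1r.
  - by move=> i _ ->; exists (i, i, false); rewrite /valid /= eqxx // orbT.
case=> -[[i j] s] ve ->; rewrite !inE; move: ve; rewrite /valid /=.
case/orP=> [ltij|/andP[/eqP <- _]].
  rewrite ifN ?neq_ltn ?ltij //; apply/orP; left; apply/orP.
  case: s; [right|left]; apply/imfsetP; exists (i, j) => //=.
    by rewrite expr1 scaleN1r.
  by rewrite expr0 scale1r.
by rewrite eqxx; apply/orP; right; apply/imfsetP; exists i.
Qed.

Lemma map_intr_inj m k : injective (map_mx intr : 'M[int]_(m, k) -> 'M[R]_(m, k)).
Proof.
move=> A B /matrixP eqAB; apply/matrixP=> i j; have := eqAB i j.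
by rewrite !mxE => /eqP; rewrite eqr_int => /eqP.
Qed.

Lemma root_vec_real_inj : {in @valid n &, injective (root_vec T R)}.
Proof.
move=> e f ve vf; rewrite -(map_root_vec T R e) -(map_root_vec T R f) => /map_intr_inj.
exact: root_vec_inj.
Qed.

Definition roots_of S : {fset 'rV[R]_n} := [fset root_vec T R e | e in S]%fset.

(** A negative root is absorbed by changing the sign of [m], and the equation descends to the
    integers because roots are integral. *)
Lemma root_diffP e f : root_diff T e f <->
  exists (c : 'rV[R]_n) (m : int), [/\ c \in root_system R n T, m != 0
    & root_vec T R e - root_vec T R f = c *~ m].
Proof.
split=> [[g [m [vg m0 eqm]]]|[c [m [cR m0 eqm]]]].
  exists (root_vec T R g), m; split=> //.
    by rewrite inE; apply/orP; left; apply/pos_rootsP; exists g.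
  rewrite -(map_root_vec T R e) -(map_root_vec T R f) -map_mxB eqm map_mxZ /=.
  by rewrite scaler_int map_root_vec.
suff [g vg [k k0 eqk]] : exists2 g, valid g & exists2 k : int, k != 0 &
    c *~ m = root_vec T R g *~ k.
  exists g, k; split=> //; apply: map_intr_inj.
  by rewrite map_mxB map_mxZ !map_root_vec eqm eqk /= scaler_int.
move: cR; rewrite inE => /orP[/pos_rootsP[g vg ->]|/imfsetP[d /= /pos_rootsP[g vg ->] ->]].
  by exists g => //; exists m.
by exists g => //; exists (- m); rewrite ?oppr_eq0 // mulrNz mulNrz.
Qed.

Lemma quasi_antichainP S : {in S, forall e, valid e} ->
  quasi_antichain T (roots_of S) <->
  {in S &, forall e f, e != f -> ~ root_diff T e f}.
Proof.
move=> vS; split=> [[_ qaS] e f eS fS ne /root_diffP[c [m [cR m0 eqm]]]|qaS].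
  apply: (qaS _ _ _ _ _ c m cR m0 eqm); [exact: in_imfset | exact: in_imfset |].
  by apply: contra ne => /eqP/root_vec_real_inj-> //; apply: vS.
split=> [|_ _ /imfsetP[e /= eS ->] /imfsetP[f /= fS ->] ne c m cR m0 eqm].
  by apply/fsubsetP=> _ /imfsetP[e /= eS ->]; apply/pos_rootsP; exists e; rewrite // vS.
apply: (qaS e f eS fS); first by apply: contra ne => /eqP->.
by apply/root_diffP; exists c, m.
Qed.

Lemma quasi_antichain_conflict_free S : {in S, forall e, valid e} ->
  quasi_antichain T (roots_of S) -> conflict_free S.
Proof.
move=> vS /(quasi_antichainP vS) qaS; split=> // e f eS fS.
apply/negP => cf; have /andP[ne _] := cf.
by apply: (qaS e f eS fS ne); apply: conflict_root_diff => //; apply: vS.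
Qed.

Lemma card_solutions_Fp S p N : prime p -> p = N.*2.+1 -> (4 < p)%N -> (n <= N)%N ->
  {in S, forall e, valid e} ->
  #|solutions T p S|%:R =
  if `[< quasi_antichain T (roots_of S) >]
  then \prod_(#|S| <= j < n) (p%:R - 2%:R * j%:R - 1) else 0 :> int.
Proof.
move=> pr_p def_p p_gt4 leN vS; case: asboolP => [qaS|nqa].
  rewrite (card_solutions_sat T pr_p def_p) card_placements //; last first.
    exact: quasi_antichain_conflict_free.
  rewrite natr_prod.
  rewrite big_nat_cond [RHS]big_nat_cond; apply: eq_bigr => j /andP[/andP[_ ltj] _].
  (* Since [p = 2N + 1] and [j < n <= N], the factor [2 (N - j)] equals [p - 2j - 1]. *)
  by rewrite def_p natrM natrB; lia.
have [e [f [eS fS rd]]] : exists e f, [/\ e \in S, f \in S & root_diff T e f].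
  apply: contrapT => nex; apply: nqa; apply/(quasi_antichainP vS) => e f eS fS _ rd.
  by apply: nex; exists e, f.
by rewrite (solutions_root_diff pr_p p_gt4 eS fS rd) cards0.
Qed.

(** * The arrangement Shi(G) *)

Section Shi.
Variable G : {fset 'rV[R]_n}.
Hypothesis sG : (G `<=` pos_roots R n T)%fset.

Definition codes_of : {set code n} := [set e | valid e & root_vec T R e \in G].

Lemma codes_of_valid S : S \subset codes_of -> {in S, forall e, valid e}.
Proof. by move=> /fintype.subsetP sS e /sS; rewrite finset.inE => /andP[]. Qed.

Lemma roots_of_inj : {in [set S : {set code n} | S \subset codes_of] &, injective roots_of}.
Proof.
move=> A B; rewrite !finset.inE => /codes_of_valid vA /codes_of_valid vB eqAB.
have sub (C D : {set code n}) : {in C, forall e, valid e} -> {in D, forall e, valid e} ->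
    roots_of C = roots_of D -> C \subset D.
  move=> vC vD eqCD; apply/fintype.subsetP=> e eC.
  have : root_vec T R e \in roots_of D by rewrite -eqCD in_imfset.
  case/imfsetP=> f /= fD /root_vec_real_inj-> //; [exact: vC | exact: vD].
by apply/eqP; rewrite finset.eqEsubset !sub.
Qed.

Lemma card_roots_of S : {in S, forall e, valid e} -> #|` roots_of S| = #|S|.
Proof.
move=> vS; apply: card_fset_image => e f eS fS.
by apply: root_vec_real_inj; apply: vS.
Qed.

Lemma StirE k : (k <= n)%N -> Stir T G (n - k) =
  #|[set S : {set code n} | (S \subset codes_of) &&
      `[< quasi_antichain T (roots_of S) >] & #|S| == k]|.
Proof.
move=> lek; set A := [set S | _ & _].
rewrite -(card_fset_image (f := roots_of) (A := A)); last first.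
  by move=> C D; rewrite !finset.inE => /andP[/andP[sC _] _] /andP[/andP[sD _] _];
     apply: roots_of_inj; rewrite finset.inE.
congr #|` _|; apply/fsetP=> X; apply/idP/imfsetP => [|[S /=]].
  rewrite !inE /= fpowersetE => /andP[XG /andP[qaX cX]].
  have XE : X = roots_of [set e in codes_of | root_vec T R e \in X].
    apply/fsetP=> a; apply/idP/imfsetP => [aX|[e /=]]; last first.
      by rewrite finset.inE => /andP[_ eX] ->.
    have aG := fsubsetP XG a aX; have /pos_rootsP[e ve def_a] := fsubsetP sG a aG.
    by exists e => //=; rewrite !finset.inE ve -def_a aG aX.
  exists [set e in codes_of | root_vec T R e \in X] => //=.
  have sub : [set e in codes_of | root_vec T R e \in X] \subset codes_of.
    by apply/fintype.subsetP=> e; rewrite finset.inE => /andP[].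
  rewrite finset.inE sub -XE qaX /= -(card_roots_of (codes_of_valid sub)) -XE.
  by rewrite -(eqn_add2l (n - k)) subnK.
rewrite finset.inE => /andP[/andP[sS qaS] /eqP cS] ->; rewrite !inE /= fpowersetE qaS.
rewrite (card_roots_of (codes_of_valid sS)) cS subnK // eqxx !andbT.
apply/fsubsetP=> _ /imfsetP[e /= eS ->].
by have := fintype.subsetP sS e eS; rewrite finset.inE => /andP[].
Qed.

Lemma sum_quasi_antichains (F : nat -> int) :
  \sum_(S : {set code n} | (S \subset codes_of) && `[< quasi_antichain T (roots_of S) >])
     F #|S| = \sum_(0 <= k < n.+1) (Stir T G (n - k))%:R * F k.
Proof.
(* Group by cardinality; [inord] loses nothing, since a conflict-free set has at most [n]
   elements. *)
rewrite big_mkord (partition_big (fun S : {set code n} => inord #|S| : 'I_n.+1) xpredT) //=.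
apply: eq_bigr => k _; rewrite (StirE (ltn_ord k)) -sum1_card natr_sum mulr_suml.
apply: eq_big => [S|S /andP[/andP[sS /asboolP qaS] /eqP <-]].
  rewrite finset.inE; apply: andb_id2l => /andP[sS /asboolP qaS].
  rewrite -val_eqE /= inordK // ltnS; apply: conflict_free_card.
  by apply: quasi_antichain_conflict_free => //; apply: codes_of_valid.
rewrite mul1r inordK // ltnS; apply: conflict_free_card.
by apply: quasi_antichain_conflict_free => //; apply: codes_of_valid.
Qed.

(** The flag is the level: [false] gives the hyperplanes of [Cox], [true] those at level 1, present
    only for roots in [G]. *)
Definition shi_index : finType :=
  {x : code n * bool | valid x.1 && (x.2 ==> (root_vec T R x.1 \in G))}.

Definition shi_normal (x : shi_index) : 'rV[int]_n := root_vec T int (val x).1.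

Definition shi_level (x : shi_index) : int := (val x).2%:Z.

Lemma Shi_hyps : Shi T G = hyps (@int_hyperplane R n _ shi_normal shi_level).
Proof.
apply/fsetP=> H; rewrite inE; apply/orP/imfsetP => [[]/imfsetP[a /= aP ->]|[x _ ->]].
- have /pos_rootsP[e ve ->] := aP.
  have ok : valid (e, false).1 && ((e, false).2 ==> (root_vec T R (e, false).1 \in G)).
    by rewrite /= ve.
  exists (exist _ (e, false) ok) => //.
  by rewrite /int_hyperplane /shi_normal /shi_level /= map_root_vec.
- have /pos_rootsP[e ve def_a] := fsubsetP sG _ aP.
  have ok : valid (e, true).1 && ((e, true).2 ==> (root_vec T R (e, true).1 \in G)).
    by rewrite /= ve -def_a.
  exists (exist _ (e, true) ok) => //.
  by rewrite /int_hyperplane /shi_normal /shi_level /= map_root_vec def_a.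
case: x => -[e b] ok; have /= /andP[ve bG] := ok.
rewrite /int_hyperplane /shi_normal /shi_level /= map_root_vec.
case: b {ok} bG => /= [eG|_]; [right|left]; apply/imfsetP; exists (root_vec T R e) => //=.
by apply/pos_rootsP; exists e.
Qed.

(** Inclusion-exclusion over the level 1 hyperplanes alone, carried out inside the regular
    points. *)
Lemma card_complement p :
  #|[set v : 'rV['F_p]_n | [forall x, ~~ point_mod shi_normal shi_level x v]]|%:R =
  \sum_(S : {set code n} | S \subset codes_of) (-1) ^+ #|S| * #|solutions T p S|%:R :> int.
Proof.
pose D v := [set e in codes_of | pairing (v : 'rV['F_p]_n) (root_vec T int e) == 1].
transitivity (\sum_(v : 'rV['F_p]_n | regular T v)
    \sum_(S : {set code n} | S \subset D v) (-1) ^+ #|S| : int); last first.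
  rewrite (exchange_big_dep (fun S : {set code n} => S \subset codes_of)) /=; last first.
    move=> v S _ sS; apply: fintype.subset_trans sS _.
    by apply/fintype.subsetP=> e; rewrite finset.inE => /andP[].
  apply: eq_bigr => S sS; rewrite -[X in _ * X%:R]sum1_card natr_sum mulr_sumr.
  apply: eq_big => [v|v _]; last by rewrite mulr1.
  rewrite finset.inE; congr andb; apply/fintype.subsetP/forall_inP => sub e eS.
    by have := sub e eS; rewrite finset.inE => /andP[].
  by rewrite finset.inE sub ?(fintype.subsetP sS).
rewrite -sum1_card natr_sum [LHS]big_mkcond [RHS]big_mkcond; apply: eq_bigr => v _.
rewrite sum_sign_subsets finset.inE.
have -> : [forall x, ~~ point_mod shi_normal shi_level x v] =
          regular T v && (D v == finset.set0).
  apply/forallP/andP => [vP|[/forall_inP reg /eqP D0] [[e b] /= ok]].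
    split.
      apply/forall_inP=> e ve.
      have ok : valid (e, false).1 && ((e, false).2 ==> (root_vec T R (e, false).1 \in G)).
        by rewrite /= ve.
      exact: (vP (exist _ (e, false) ok)).
    apply/eqP/setP=> e; rewrite finset.in_set0; apply/negP.
    rewrite !finset.inE => /andP[/andP[ve eG] e1].
    have ok : valid (e, true).1 && ((e, true).2 ==> (root_vec T R (e, true).1 \in G)).
      by rewrite /= ve.
    by have /negP := vP (exist _ (e, true) ok); apply.
  rewrite /point_mod /shi_normal /shi_level /=.
  case: b ok => /= /andP[ve]; last by move=> _; apply: reg.
  move=> eG; apply/negP => e1; have := finset.in_set0 e; rewrite -D0.
  by rewrite !finset.inE ve eG /=; move/negP; apply.
by case: (regular T v); case: eqP.
Qed.

End Shi.
End Roots.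

Theorem theorem3 (R : realType) (n : nat) (T : BCtype) (G : {fset 'rV[R]_n}) :
  (2 <= n)%N -> (G `<=` pos_roots R n T)%fset ->
  char_poly_arr (Shi T G) =
    \sum_(0 <= k < n.+1)
      (-1) ^+ k * (Stir T G (n - k))%:R
      * \prod_(k <= j < n) ('X - 2%:R * j%:R - 1 : {poly int}).
Proof.
move=> _ sG; rewrite Shi_hyps //.
have [|p0 ffm] := @finite_field_method R n _ (@shi_normal R n T G) (@shi_level R n T G).
  case=> -[[[i j] s] b] ok; rewrite /shi_normal /=; apply/eqP => /rowP/(_ i).
  by rewrite root_vecE mxE eqxx; case: (eqVneq i j) => [_|_]; [case: (T) | rewrite mulr0].
apply: poly_int_eq_cofinal => m.
(* Here [m] makes the primes unbounded, [p0] serves the finite field method, [2n + 1] ensures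
   [n <= N], and 4 bounds the multiples in differences of roots. *)
have [p] := prime_above (maxn m (maxn p0 (maxn n.*2.+1 4))).
rewrite !gtn_max => /and4P[ltm ltp0 ltn p_gt4] pr_p; exists p => //.
have def_p : p = p./2.*2.+1.
  have := odd_double_half p; case: (even_prime pr_p) => [p2|->]; last by [].
  by rewrite p2 in p_gt4.
rewrite ffm // card_complement.
transitivity (\sum_(S : {set code n} | (S \subset codes_of T G) &&
    `[< quasi_antichain T (roots_of R T S) >])
  (-1) ^+ #|S| * \prod_(#|S| <= j < n) (p%:R - 2%:R * j%:R - 1) : int).
  rewrite [RHS]big_mkcondr; apply: eq_bigr => S sS.
  rewrite (card_solutions_Fp R T pr_p def_p) //; last exact: (codes_of_valid sS).
    by case: ifP => _; rewrite ?mulr0.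
  by lia.
rewrite (sum_quasi_antichains sG
  (fun k => (-1) ^+ k * \prod_(k <= j < n) (p%:R - 2%:R * j%:R - 1))).
rewrite horner_sum; apply: eq_bigr => k _.
rewrite !hornerM horner_exp hornerN hornerC -polyC_natr hornerC horner_prod mulrCA mulrA.
congr (_ * _); apply: eq_bigr => j _.
by rewrite !hornerE -polyC_natr !hornerE.
Qed.
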